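(* Let $p$ be a prime, $f\ge 1$ and $q=p^f$. Let $m = \sum_{i=0}^{f-1} m_i p^i$ with $0\leq m_i\leq p-1$ and let $V_m = \bigotimes_{i=0}^{f-1} (V_{m_i} \circ \mathrm{Fr}^i)$. Let $r = \sum_{i=0}^{f-1} r_i p^i$ with $r_i\geq (m_i+1)(q+1)-1$ for all $i$, and let $V_r = \bigotimes_{i=0}^{f-1} (V_{r_i} \circ \mathrm{Fr}^i)$. Let $d^{\,r-m}$ be the character $\bigotimes_{i=0}^{f-1} d^{(r_i-m_i)p^i}$ of $B(\mathbb{F}_q)$. If $p \nmid \prod_{i=0}^{f-1} \binom{r_i}{m_i}$ (that is, $p\nmid\binom{r_i}{m_i}$ for all $0\le i\le f-1$), then $$\dfrac{V_r}{\langle \theta_0^{m_0+1}, \theta_1^{m_1+1}, \ldots, \theta_{f-1}^{m_{f-1}+1} \rangle} \simeq \mathrm{ind}_{B(\mathbb{F}_q)}^{G(\mathbb{F}_q)} \left(V_m \otimes d^{\,r-m} \right)$$ as representations of $G(\mathbb{F}_q)=\mathrm{GL}_2(\mathbb{F}_q)$ over $\mathbb{F}_q$.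
   Context: $G(\mathbb{F}_q)=\mathrm{GL}_2(\mathbb{F}_q)$ and $B(\mathbb{F}_q)$ is its subgroup of upper triangular matrices. For $n\ge0$ and $0\le i\le f-1$, $V_{n}\circ\mathrm{Fr}^i$ is the space of homogeneous polynomials of degree $n$ over $\mathbb{F}_q$ in variables $X_i,Y_i$, with $\begin{pmatrix} a & b\\ c & d\end{pmatrix}$ acting by the $i$-th Frobenius twist of the standard action: $P(X_i,Y_i)\mapsto P(a^{p^i}X_i+c^{p^i}Y_i,\,b^{p^i}X_i+d^{p^i}Y_i)$. Thus $V_r$ is a space of multihomogeneous polynomials in $\mathbb{F}_q[X_0,Y_0,\dots,X_{f-1},Y_{f-1}]$ of degree $r_i$ in $(X_i,Y_i)$; the integers $r_i$ are part of the data (they are not determined by $r$ and are not its base-$p$ digits). The twisted Dickson polynomials are $\theta_i=X_iY_{i-1}^p-Y_iX_{i-1}^p$ for $0\le i\le f-1$, with the index convention $-1=f-1$. $\langle \theta_0^{m_0+1},\dots,\theta_{f-1}^{m_{f-1}+1}\rangle$ denotes the subspace of $V_r$ consisting of the polynomials in $V_r$ lying in the ideal of $\mathbb{F}_q[X_0,Y_0,\dots,X_{f-1},Y_{f-1}]$ generated by these elements. $d^s$ is the character $\begin{pmatrix} a & b\\ 0 & d\end{pmatrix}\mapsto d^s$ of $B(\mathbb{F}_q)$. For a representation $\sigma$ of a subgroup $H$ of a finite group $G$, $\mathrm{ind}_H^G\sigma$ is the space of functions $f:G\to\sigma$ with $f(hg)=\sigma(h)f(g)$, with $G$ acting by right translation.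 *)

(* Defs.v *)
From HB Require Import structures.
From mathcomp Require Import all_boot all_order all_fingroup all_algebra all_field.
From mathcomp Require Import boolp.
From mathcomp Require Import mpoly.
From mathcomp Require Import ring.

Set Implicit Arguments.
Unset Strict Implicit.
Unset Printing Implicit Defensive.

Import GRing.Theory.
Local Open Scope ring_scope.

(* Left linear representations of a finite group; a representation of a       *)
(* subgroup H of gT is a representation of the finGroupType [subg H].         *)
Record linrep (F : fieldType) (gT : finGroupType) := LinRep {
  rep_space :> lmodType F;
  rep_act : gT -> {linear rep_space -> rep_space};
  rep_act1 : forall v, rep_act 1%g v = v;
  rep_actM : forall g h v, rep_act (g * h)%g v = rep_act g (rep_act h v)
}.

Definition rep_iso (F : fieldType) (gT : finGroupType) (V W : linrep F gT) :=
  exists phi : {linear V -> W},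
    bijective phi /\ forall g v, phi (rep_act V g v) = rep_act W g (phi v).

Definition rep_stable (F : fieldType) (gT : finGroupType) (V : linrep F gT)
    (W : {pred V}) :=
  forall g v, v \in W -> rep_act V g v \in W.

Section SubRep.
Variables (F : fieldType) (gT : finGroupType) (V : linrep F gT).
Variable W : submodClosed V.

Record subspace := Subspace { subspace_val : V; _ : subspace_val \in W }.

HB.instance Definition _ := [isSub for subspace_val].
HB.instance Definition _ := [Choice of subspace by <:].
HB.instance Definition _ := [SubChoice_isSubLmodule of subspace by <:].

Hypothesis W_stable : rep_stable W.

Definition sub_act (g : gT) (v : subspace) : subspace :=
  Subspace (W_stable g (valP v)).

Lemma sub_act_linear g : linear (sub_act g).
Proof. by move=> a u v; apply: val_inj; rewrite /= linearP. Qed.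

HB.instance Definition _ g :=
  GRing.isLinear.Build F subspace subspace *:%R (sub_act g) (sub_act_linear g).

Lemma sub_act1 v : sub_act 1%g v = v.
Proof. by apply: val_inj; rewrite /= rep_act1. Qed.

Lemma sub_actM g h v : sub_act (g * h)%g v = sub_act g (sub_act h v).
Proof. by apply: val_inj; rewrite /= rep_actM. Qed.

Definition sub_rep : linrep F gT :=
  @LinRep F gT subspace (fun g => sub_act g) sub_act1 sub_actM.

End SubRep.

Section QuotRep.
Variables (F : fieldType) (gT : finGroupType) (V : linrep F gT).
Variable W : submodClosed V.
Local Open Scope quotient_scope.

(* submodClosed predicates do not inherit zmodClosed, which Quotient needs. *)
Definition quot_pred : {pred V} := fun v => v \in W.

Lemma quot_pred_closed : zmod_closed quot_pred.
Proof. exact: (submodClosedP W : GRing.submod_closed _). Qed.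

HB.instance Definition _ := GRing.isZmodClosed.Build V quot_pred quot_pred_closed.

Definition quot_space := Quotient.quot quot_pred.

HB.instance Definition _ := GRing.Zmodule.on quot_space.
HB.instance Definition _ := EqQuotient.on quot_space.

Lemma quot_piP (u v : V) : \pi_quot_space u = \pi_quot_space v <-> u - v \in W.
Proof. by rewrite -[_ \in W]/(_ \in quot_pred) Quotient.idealrBE; split=> /eqP. Qed.

Lemma quot_piD (u v : V) :
  \pi_quot_space (u + v) = \pi_quot_space u + \pi_quot_space v.
Proof. exact: (@Quotient.pi_add V quot_pred). Qed.

Lemma quot_spaceW (P : quot_space -> Prop) :
  (forall v : V, P (\pi_quot_space v)) -> forall x, P x.
Proof. by move=> hP x; rewrite -[x]reprK. Qed.

Definition quot_scale (a : F) (x : quot_space) : quot_space :=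
  \pi_quot_space (a *: generic_quotient.repr x).

Lemma quot_scaleE a v : quot_scale a (\pi_quot_space v) = \pi_quot_space (a *: v).
Proof. by apply/quot_piP; rewrite -scalerBr rpredZ //; apply/quot_piP; rewrite reprK. Qed.

Lemma quot_scaleA a b x : quot_scale a (quot_scale b x) = quot_scale (a * b) x.
Proof. by elim/quot_spaceW: x => x; rewrite !quot_scaleE scalerA. Qed.

Lemma quot_scale1 : left_id 1 quot_scale.
Proof. by elim/quot_spaceW=> x; rewrite quot_scaleE scale1r. Qed.

Lemma quot_scaleDr : right_distributive quot_scale +%R.
Proof.
move=> a; elim/quot_spaceW=> x; elim/quot_spaceW=> y.
by rewrite -quot_piD !quot_scaleE -quot_piD scalerDr.
Qed.

Lemma quot_scaleDl v : {morph quot_scale^~ v : a b / a + b}.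
Proof. by elim/quot_spaceW: v => x a b; rewrite !quot_scaleE -quot_piD scalerDl. Qed.

HB.instance Definition _ := GRing.Zmodule_isLmodule.Build F quot_space
  quot_scaleA quot_scale1 quot_scaleDr quot_scaleDl.

Hypothesis W_stable : rep_stable W.

Definition quot_act (g : gT) (x : quot_space) : quot_space :=
  \pi_quot_space (rep_act V g (generic_quotient.repr x)).

Lemma quot_actE g v : quot_act g (\pi_quot_space v) = \pi_quot_space (rep_act V g v).
Proof. by apply/quot_piP; rewrite -linearB W_stable //; apply/quot_piP; rewrite reprK. Qed.

Lemma quot_act_linear g : linear (quot_act g).
Proof.
move=> a; elim/quot_spaceW=> x; elim/quot_spaceW=> y.
rewrite -![a *: _]/(quot_scale a _) quot_scaleE -quot_piD !quot_actE.
by rewrite quot_scaleE -quot_piD linearP.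
Qed.

HB.instance Definition _ g :=
  GRing.isLinear.Build F quot_space quot_space *:%R (quot_act g) (quot_act_linear g).

Lemma quot_act1 x : quot_act 1%g x = x.
Proof. by elim/quot_spaceW: x => x; rewrite quot_actE rep_act1. Qed.

Lemma quot_actM g h x : quot_act (g * h)%g x = quot_act g (quot_act h x).
Proof. by elim/quot_spaceW: x => x; rewrite !quot_actE rep_actM. Qed.

Definition quot_rep : linrep F gT :=
  @LinRep F gT quot_space (fun g => quot_act g) quot_act1 quot_actM.

End QuotRep.

Section ResRep.
Variables (F : fieldType) (gT : finGroupType) (H : {group gT}).
Variable V : linrep F gT.

Lemma res_act1 (v : V) : rep_act V (sgval (1%g : [subg H])) v = v.
Proof. exact: rep_act1. Qed.

Lemma res_actM (g h : [subg H]) (v : V) :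
  rep_act V (sgval (g * h)%g) v = rep_act V (sgval g) (rep_act V (sgval h) v).
Proof. exact: rep_actM. Qed.

Definition res_rep : linrep F [subg H] :=
  @LinRep F [subg H] V (fun h => rep_act V (sgval h)) res_act1 res_actM.

End ResRep.

Record linchar (F : fieldType) (gT : finGroupType) := LinChar {
  linchar_fun :> gT -> F;
  linchar1 : linchar_fun 1%g = 1;
  lincharM : {morph linchar_fun : g h / (g * h)%g >-> g * h}
}.

Section TwistRep.
Variables (F : fieldType) (gT : finGroupType).
Variables (V : linrep F gT) (chi : linchar F gT).

Definition twist_act (g : gT) (v : V) : V := chi g *: rep_act V g v.

Lemma twist_act_linear g : linear (twist_act g).
Proof. by move=> a u v; rewrite /twist_act linearP scalerDr !scalerA mulrC. Qed.

HB.instance Definition _ g :=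
  GRing.isLinear.Build F V V *:%R (twist_act g) (twist_act_linear g).

Lemma twist_act1 v : twist_act 1%g v = v.
Proof. by rewrite /twist_act linchar1 scale1r rep_act1. Qed.

Lemma twist_actM g h v : twist_act (g * h)%g v = twist_act g (twist_act h v).
Proof. by rewrite /twist_act lincharM linearZ /= scalerA rep_actM. Qed.

(* V (x) chi, realized on V through V (x) F = V. *)
Definition twist_rep : linrep F gT :=
  @LinRep F gT V (fun g => twist_act g) twist_act1 twist_actM.

End TwistRep.

Section IndRep.
Variables (F : fieldType) (gT : finGroupType) (H : {group gT}).
Variable V : linrep F [subg H].

Definition rtrans_act (g : gT) (u : {ffun gT -> V}) : {ffun gT -> V} :=
  [ffun x => u (x * g)%g].

Lemma rtrans_act_linear g : linear (rtrans_act g).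
Proof. by move=> a u v; apply/ffunP=> x; rewrite !ffunE. Qed.

HB.instance Definition _ g :=
  GRing.isLinear.Build F {ffun gT -> V} {ffun gT -> V} *:%R
    (rtrans_act g) (rtrans_act_linear g).

Lemma rtrans_act1 u : rtrans_act 1%g u = u.
Proof. by apply/ffunP=> x; rewrite !ffunE mulg1. Qed.

Lemma rtrans_actM g h u : rtrans_act (g * h)%g u = rtrans_act g (rtrans_act h u).
Proof. by apply/ffunP=> x; rewrite !ffunE mulgA. Qed.

Definition rtrans_rep : linrep F gT :=
  @LinRep F gT {ffun gT -> V} (fun g => rtrans_act g) rtrans_act1 rtrans_actM.

Definition equivariant : {pred rtrans_rep} := fun u : {ffun gT -> V} =>
  [forall h : [subg H], forall g, u (sgval h * g)%g == rep_act V h (u g)].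

Lemma equivariantP (u : {ffun gT -> V}) :
  reflect (forall (h : [subg H]) g, u (sgval h * g)%g = rep_act V h (u g))
          (u \in equivariant).
Proof.
apply: (iffP forallP) => hu h.
  by move=> g; apply/eqP; apply/forallP: g.
by apply/forallP=> g; apply/eqP.
Qed.

Lemma equivariant_submod : submod_closed equivariant.
Proof.
split=> [|a u v /equivariantP hu /equivariantP hv]; apply/equivariantP=> h g.
  by rewrite !ffunE linear0.
by rewrite !ffunE hu hv linearP.
Qed.

HB.instance Definition _ :=
  GRing.isSubmodClosed.Build F rtrans_rep equivariant equivariant_submod.

Lemma equivariant_stable : rep_stable equivariant.
Proof.
move=> g u /equivariantP hu; apply/equivariantP=> h x.
by rewrite !ffunE -mulgA hu.
Qed.

(* Functions u : gT -> V with u (h g) = h . u g, under right translation.     *)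
Definition ind_rep : linrep F gT := sub_rep equivariant_stable.

End IndRep.

Section Borel.
Variable F : finFieldType.

Definition gl2_mx (g : {'GL_2[F]}) : 'M[F]_2 := GLval g.

Arguments gl2_mx : simpl never.

Lemma gl2_mx1 : gl2_mx 1%g = 1%:M.
Proof. by []. Qed.

Lemma gl2_mxM g h i j :
  gl2_mx (g * h)%g i j = gl2_mx g i 0 * gl2_mx h 0 j + gl2_mx g i 1 * gl2_mx h 1 j.
Proof.
rewrite /gl2_mx GL_MxE mxE big_ord_recl big_ord1.
by congr (_ * _ + gl2_mx g _ _ * gl2_mx h _ _); apply: val_inj.
Qed.

Definition borel_set : {set {'GL_2[F]}} := [set g | gl2_mx g 1 0 == 0].

Lemma borel_group_set : group_set borel_set.
Proof.
apply/group_setP; split=> [|g h]; rewrite !inE; first by rewrite gl2_mx1 mxE.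
by move=> /eqP g0 /eqP h0; rewrite gl2_mxM g0 h0 mul0r mulr0 addr0.
Qed.

Canonical borel := Group borel_group_set.

Variables (p f : nat) (r m : 'I_f -> nat).

(* The tensor product over i of the characters d^((r_i - m_i) p^i); the       *)
(* exponents are only meaningful when m_i <= r_i.                             *)
Definition dchar_fun (b : [subg borel]) : F :=
  \prod_(i < f) gl2_mx (sgval b) 1 1 ^+ ((r i - m i) * p ^ i).

Lemma dchar1 : dchar_fun 1%g = 1.
Proof. by rewrite /dchar_fun big1 // => i _; rewrite gl2_mx1 mxE expr1n. Qed.

Lemma dcharM : {morph dchar_fun : g h / (g * h)%g >-> g * h}.
Proof.
move=> g h; rewrite /dchar_fun -big_split; apply: eq_bigr => i _.
have := subgP g; rewrite inE => /eqP g0.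
rewrite (_ : sgval (g * h)%g = (sgval g * sgval h)%g) //.
by rewrite gl2_mxM g0 mul0r add0r exprMn.
Qed.

Definition dchar : linchar F [subg borel] := LinChar dchar1 dcharM.

End Borel.

Section Polynomials.
Variables (F : finFieldType) (f : nat).

Definition varX (i : 'I_f) : {mpoly F[f + f]} := 'X_(lshift f i).
Definition varY (i : 'I_f) : {mpoly F[f + f]} := 'X_(rshift f i).

Definition bideg (i : 'I_f) (mon : 'X_{1..f + f}) : nat :=
  (mon (lshift f i) + mon (rshift f i))%N.

Lemma bideg0 i : bideg i 0%MM = 0%N.
Proof. by rewrite /bideg !mnm0E. Qed.

Lemma bidegD i : {morph bideg i : m1 m2 / (m1 + m2)%MM >-> (m1 + m2)%N}.
Proof. by move=> m1 m2; rewrite /bideg !mnmDE addnACA. Qed.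

HB.instance Definition _ i := isMeasure.Build (f + f)%N (bideg i) (bideg0 i) (bidegD i).

Definition multihomog (r : 'I_f -> nat) : {pred {mpoly F[f + f]}} :=
  fun P => [forall i, P \is (r i).-homog for (bideg i)].

Lemma multihomog_submod r : submod_closed (multihomog r).
Proof.
split=> [|a P Q /forallP hP /forallP hQ]; apply/forallP=> i; first exact: dhomog0.
by apply: rpredD; [apply: rpredZ; apply: hP | apply: hQ].
Qed.

(* theta_i, with theta_0 = X_0 Y_(f-1)^p - Y_0 X_(f-1)^p since ord_pred 0     *)
(* is f-1.                                                                    *)
Definition theta (p : nat) (i : 'I_f) : {mpoly F[f + f]} :=
  varX i * varY (ord_pred i) ^+ p - varY i * varX (ord_pred i) ^+ p.

Definition in_ideal (gen : 'I_f -> {mpoly F[f + f]}) (P : {mpoly F[f + f]}) : Prop :=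
  exists h : 'I_f -> {mpoly F[f + f]}, P = \sum_(i < f) h i * gen i.

End Polynomials.

Section PolyRep.
Variables (p f : nat) (F : finFieldType).
Hypotheses (p_pr : prime p) (cardF : #|F| = (p ^ f)%N).

(* With g = [[a, b], [c, d]]: X_i |-> a^(p^i) X_i + c^(p^i) Y_i and            *)
(* Y_i |-> b^(p^i) X_i + d^(p^i) Y_i.                                         *)
Definition subst_var (g : {'GL_2[F]}) (k : 'I_(f + f)) : {mpoly F[f + f]} :=
  match split k with
  | inl i => gl2_mx g 0 0 ^+ (p ^ i) *: varX F i + gl2_mx g 1 0 ^+ (p ^ i) *: varY F i
  | inr i => gl2_mx g 0 1 ^+ (p ^ i) *: varX F i + gl2_mx g 1 1 ^+ (p ^ i) *: varY F i
  end.

Definition poly_act (g : {'GL_2[F]}) (P : {mpoly F[f + f]}) : {mpoly F[f + f]} :=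
  P \mPo [tuple subst_var g k | k < f + f].

Lemma poly_act_linear g : linear (poly_act g).
Proof. by move=> a P Q; rewrite /poly_act linearP. Qed.

HB.instance Definition _ g :=
  GRing.isLinear.Build F {mpoly F[f + f]} {mpoly F[f + f]} *:%R
    (poly_act g) (poly_act_linear g).

Lemma poly_act_mult g : monoid_morphism (poly_act g).
Proof. by split=> [|P Q]; rewrite /poly_act ?rmorph1 ?rmorphM. Qed.

HB.instance Definition _ g :=
  GRing.isMonoidMorphism.Build {mpoly F[f + f]} {mpoly F[f + f]}
    (poly_act g) (poly_act_mult g).

Lemma poly_act_var g k : poly_act g 'X_k = subst_var g k.
Proof. by rewrite /poly_act comp_mpolyXU (nth_map k) ?size_enum_ord // nth_ord_enum. Qed.

Lemma poly_actX g i : poly_act g (varX F i) =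
  gl2_mx g 0 0 ^+ (p ^ i) *: varX F i + gl2_mx g 1 0 ^+ (p ^ i) *: varY F i.
Proof. by rewrite poly_act_var /subst_var (unsplitK (inl i)). Qed.

Lemma poly_actY g i : poly_act g (varY F i) =
  gl2_mx g 0 1 ^+ (p ^ i) *: varX F i + gl2_mx g 1 1 ^+ (p ^ i) *: varY F i.
Proof. by rewrite poly_act_var /subst_var (unsplitK (inr i)). Qed.

Lemma poly_act_ext (u v : {lrmorphism {mpoly F[f + f]} -> {mpoly F[f + f]}}) :
  (forall k, u 'X_k = v 'X_k) -> u =1 v.
Proof.
move=> uv P; rewrite [P]mpolyE !linear_sum /=; apply: eq_bigr => mon _.
rewrite !linearZ /=; congr (_ *: _); rewrite mpolyXE_id !rmorph_prod /=.
by apply: eq_bigr => k _; rewrite !rmorphXn /= uv.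
Qed.

Lemma pchar_F : p \in [pchar F].
Proof. exact: card_finPcharP cardF p_pr. Qed.

Lemma frobD (R : comNzRingType) (x y : R) i :
  p \in [pchar R] -> (x + y) ^+ (p ^ i) = x ^+ (p ^ i) + y ^+ (p ^ i).
Proof.
by move=> pR; apply: exprDn_pchar; rewrite pnatX (eq_pnat _ (pcharf_eq pR)) pnat_id.
Qed.

Lemma pchar_mpoly : p \in [pchar {mpoly F[f + f]}].
Proof.
rewrite inE p_pr /= -mpolyC_nat.
by rewrite (pcharf0 pchar_F) mpolyC0.
Qed.

Lemma poly_act1 P : poly_act 1%g P = P.
Proof.
rewrite -[RHS](comp_mpoly_id P) /poly_act; congr (P \mPo _).
have p0 i : (0 : F) ^+ (p ^ i) = 0 by rewrite expr0n expn_eq0 eqn0Ngt prime_gt0.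
have m00 : gl2_mx (1%g : {'GL_2[F]}) 0 0 = 1 by rewrite gl2_mx1 mxE.
have m01 : gl2_mx (1%g : {'GL_2[F]}) 0 1 = 0 by rewrite gl2_mx1 mxE.
have m10 : gl2_mx (1%g : {'GL_2[F]}) 1 0 = 0 by rewrite gl2_mx1 mxE.
have m11 : gl2_mx (1%g : {'GL_2[F]}) 1 1 = 1 by rewrite gl2_mx1 mxE.
apply: eq_from_tnth => k; rewrite !tnth_mktuple /subst_var m00 m01 m10 m11.
by case: split_ordP => i ->; rewrite expr1n p0 scale1r scale0r ?addr0 ?add0r.
Qed.

Lemma poly_actM g h P : poly_act (g * h)%g P = poly_act g (poly_act h P).
Proof.
rewrite -[RHS]/((poly_act g \o poly_act h) P).
apply: poly_act_ext => k /=; rewrite !poly_act_var /subst_var.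
have FD := frobD _ _ _ pchar_F.
case: (split k) => i; rewrite linearD !linearZ /= poly_actX poly_actY !gl2_mxM.
  rewrite !FD !exprMn !scalerDr !scalerDl !scalerA.
  by rewrite addrACA; congr (_ *: _ + _ *: _ + (_ *: _ + _ *: _)); rewrite mulrC.
rewrite !FD !exprMn !scalerDr !scalerDl !scalerA.
by rewrite addrACA; congr (_ *: _ + _ *: _ + (_ *: _ + _ *: _)); rewrite mulrC.
Qed.

Definition poly_rep : linrep F {'GL_2[F]} :=
  @LinRep F {'GL_2[F]} {mpoly F[f + f]} (fun g => poly_act g) poly_act1 poly_actM.

HB.instance Definition _ r :=
  GRing.isSubmodClosed.Build F poly_rep (@multihomog F f r) (@multihomog_submod F f r).

Lemma subst_var_homog g k i :
  subst_var g k \is (bideg i U_(k)%MM).-homog for (bideg i).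
Proof.
rewrite /subst_var; case: split_ordP => j ->;
  apply: rpredD; apply: rpredZ; rewrite dhomogX /= /bideg !mnm1E;
  by rewrite ?eq_lshift ?eq_rshift ?eq_lrshift ?eq_rlshift ?addn0 ?add0n.
Qed.

Lemma bideg_sum i (mon : 'X_{1..f + f}) :
  bideg i mon = (\sum_k bideg i U_(k)%MM * mon k)%N.
Proof.
rewrite big_split_ord /=; congr (_ + _)%N; rewrite (bigD1 i) //= big1 ?addn0.
- by rewrite /bideg !mnm1E ?eq_lshift ?eq_rshift ?eq_lrshift ?eq_rlshift eqxx addn0 mul1n.
- by move=> j ji; rewrite /bideg !mnm1E ?eq_lshift ?eq_rshift ?eq_lrshift ?eq_rlshift (negPf ji).
- by rewrite /bideg !mnm1E ?eq_lshift ?eq_rshift ?eq_lrshift ?eq_rlshift eqxx add0n mul1n.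
- by move=> j ji; rewrite /bideg !mnm1E ?eq_lshift ?eq_rshift ?eq_lrshift ?eq_rlshift (negPf ji).
Qed.

Lemma multihomog_stable r : rep_stable (V := poly_rep) (@multihomog F f r).
Proof.
move=> g P /forallP hP; apply/forallP=> i.
rewrite /= [P]mpolyE linear_sum big_seq; apply: rpred_sum => mon monP.
rewrite linearZ /=; apply: rpredZ.
rewrite -(dhomogP _ _ _ (hP i) _ monP) /= bideg_sum mpolyXE_id rmorph_prod /=.
apply: (big_rec2 (fun d Q => Q \is d.-homog for (bideg i))) => [|k d Q _ hQ].
  exact: dhomog1.
rewrite dhomogM // rmorphXn /= poly_act_var; apply: dhomogMn.
exact: subst_var_homog.
Qed.

(* The tensor product over i of the V_(r_i) o Fr^i, realized as the           *)
(* polynomials of degree r_i in (X_i, Y_i) for every i.                       *)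
Definition Vrep (r : 'I_f -> nat) : linrep F {'GL_2[F]} :=
  sub_rep (@multihomog_stable r).

Lemma theta_act g i :
  poly_act g (theta F p i) = (\det (gl2_mx g)) ^+ (p ^ i) *: theta F p i.
Proof.
set j := ord_pred i.
have E (x : F) : (x ^+ (p ^ j)) ^+ p = x ^+ (p ^ i).
  rewrite -exprM -expnSr /j; case: i {j} => -[|i] i_lt /=.
    by rewrite add0n modn_small ?prednK // expn0 -cardF expf_card.
  by rewrite ?addSn /= modnDr modn_small // ltnW.
have FP (x y : {mpoly F[f + f]}) : (x + y) ^+ p = x ^+ p + y ^+ p.
  by have := frobD x y 1 pchar_mpoly; rewrite expn1.
have det2 : \det (gl2_mx g) =
    gl2_mx g 0 0 * gl2_mx g 1 1 - gl2_mx g 0 1 * gl2_mx g 1 0.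
  rewrite (expand_det_row _ 0) big_ord_recl big_ord1 /cofactor !det_mx11 !mxE /=.
  rewrite expr0 expr1 mul1r mulN1r mulrN.
  by congr (_ * gl2_mx g _ _ - gl2_mx g _ _ * gl2_mx g _ _); apply: val_inj.
have -> : \det (gl2_mx g) ^+ (p ^ i) =
    gl2_mx g 0 0 ^+ (p ^ i) * gl2_mx g 1 1 ^+ (p ^ i)
    - gl2_mx g 0 1 ^+ (p ^ i) * gl2_mx g 1 0 ^+ (p ^ i).
  rewrite det2 frobD ?pchar_F // -!exprMn; congr (_ + _).
  apply: (addrI ((gl2_mx g 0 1 * gl2_mx g 1 0) ^+ (p ^ i))).
  by rewrite -frobD ?pchar_F // !subrr expr0n expn_eq0 eqn0Ngt prime_gt0.
rewrite /theta -/j raddfB /= !rmorphM !rmorphXn /= !poly_actX !poly_actY.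
rewrite !FP !exprZn !E -!mul_mpolyC mpolyCB !mpolyCM.
ring.
Qed.

(* The elements of V_r in the ideal of the whole polynomial ring generated by *)
(* the theta_i^(m_i + 1); the cofactors need not be multihomogeneous.         *)
Definition theta_span (r m : 'I_f -> nat) : {pred Vrep r} := fun P =>
  `[< in_ideal (fun i => theta F p i ^+ (m i).+1) (subspace_val P) >].

Arguments theta_span : clear implicits.

Lemma theta_span_submod r m : submod_closed (theta_span r m).
Proof.
split=> [|a P Q /asboolP [h hP] /asboolP [k kQ]]; apply/asboolP.
  by exists (fun=> 0); rewrite big1 // => i _; rewrite mul0r.
exists (fun i => a *: h i + k i).
rewrite /= hP kQ scaler_sumr -big_split /=; apply: eq_bigr => i _.
by rewrite mulrDl scalerAl.
Qed.

HB.instance Definition _ r m :=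
  GRing.isSubmodClosed.Build F (Vrep r) (theta_span r m)
    (theta_span_submod r m).

Lemma theta_span_stable r m : rep_stable (V := Vrep r) (theta_span r m).
Proof.
move=> g P /asboolP [h hP]; apply/asboolP.
exists (fun i : 'I_f => (\det (gl2_mx g) ^+ (p ^ i)) ^+ (m i).+1 *: poly_act g (h i)).
rewrite /= hP linear_sum; apply: eq_bigr => i _.
by rewrite /= rmorphM rmorphXn /= theta_act exprZn -scalerAr -scalerAl.
Qed.

Definition Vquot (r m : 'I_f -> nat) : linrep F {'GL_2[F]} :=
  quot_rep (@theta_span_stable r m).

End PolyRep.

(* Main.v *)
From HB Require Import structures.
From mathcomp Require Import all_boot all_fingroup all_algebra finfield.
From mathcomp Require Import boolp.
From mathcomp Require Import mpoly.
From mathcomp Require Import ring zify.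
Require Import Defs.

Set Implicit Arguments.
Unset Strict Implicit.
Unset Printing Implicit Defensive.

Import GRing.Theory.
Local Open Scope ring_scope.

(** Write q = p^f. The quotient is compared with the induced representation
through the order-m Taylor expansions (jets) of a polynomial at the q + 1 points
of the projective line over F_q.

At the point fixed by the Borel subgroup, where all X_i vanish, the expansion is
taken by [hasse]: the divided-power derivative of order r_i - m_i in each Y_i,
which sends prod X_i^a_i Y_i^(r_i - a_i) to
prod C(r_i - a_i, r_i - m_i) X_i^a_i Y_i^(m_i - a_i). Being the coefficient of
prod T_i^(r_i - m_i) in P(X, Y + T), it is equivariant for upper triangular
matrices up to the character d^(r - m) ([hasse_upper_act]). Hence
P |-> (g |-> hasse (g P)) is a morphism [jet] from V_r to the induced
representation. Three facts make it an isomorphism modulo the theta ideal.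

It kills the ideal: theta_i^(m_i + 1) lies in the ideal generated by the
X_j^(m_j + 1), because m_j < p and theta_i = X_i Y_(i-1)^p modulo X_(i-1)^p, and
the theta ideal is stable under the group ([hasse_act_in_ideal]).

It is onto: the binomial condition makes all coefficients
C(r_i - a_i, r_i - m_i) with a_i <= m_i nonzero mod p, and multiplying a monomial
by a power of prod_(l in F_q) (Y_i - l^(p^i) X_i) = Y_i^q - Y_i X_i^(q-1) makes it
vanish to high order at every point but one without changing its jet there
([hasse_local_poly], [hasse_act_local_poly]). Translating by the group gives
arbitrary jets at all points ([coords_surj]).

It remains to bound the quotient from above. Modulo theta_i the monomial
X_(i-1)^p Y_i may be replaced by X_i Y_(i-1)^p. This is a carry in base p among
the exponents of the X_i, and each carry lowers their sum. When all degrees are at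
least p, the monomials admitting no carry are those whose X-exponents are all
below p, q in number, and the one containing no Y at all. So modulo the ideal
V_r is spanned by the products theta^a M with a <= m and M one of q + 1 monomials
([homog_spanned]). These are as many as the coordinates of an induced function,
so by counting over the finite field a surjection between the two coordinate
spaces is injective, and the kernel of the jet map is exactly the theta ideal
([coords_eq0]). *)

(** * Multihomogeneous monomials and vanishing along X = 0 *)

Section Monomials.
Variables (F : finFieldType) (f : nat).
Implicit Types (n k m a : 'I_f -> nat) (P Q : {mpoly F[f + f]}).

(** prod X_i^k_i Y_i^(n_i - k_i). The truncated subtraction makes this a monomial
of multidegree n exactly when k <= n. *)
Definition mon n k : 'X_{1..f + f} :=
  [multinom match split z with inl i => k i | inr i => (n i - k i)%N end
  | z < f + f].

Lemma monX n k i : mon n k (lshift f i) = k i.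
Proof. by rewrite mnmE (unsplitK (inl i)). Qed.

Lemma monY n k i : mon n k (rshift f i) = (n i - k i)%N.
Proof. by rewrite mnmE (unsplitK (inr i)). Qed.

Lemma eq_mon n k n' k' : n =1 n' -> k =1 k' -> mon n k = mon n' k'.
Proof.
move=> En Ek; apply/mnmP=> z.
by case: (split_ordP z) => i ->; rewrite ?monX ?monY ?En Ek.
Qed.

Lemma mon_eqX n k k' : (mon n k == mon n k') = [forall i, k i == k' i].
Proof.
apply/eqP/forallP => [E i|E]; first by rewrite -(monX n k) E monX.
by apply: eq_mon => // i; apply/eqP.
Qed.

Lemma bidegX1 (i j : 'I_f) : bideg i U_(lshift f j)%MM = (j == i).
Proof. by rewrite /bideg !mnm1E eq_lshift eq_lrshift addn0. Qed.

Lemma bidegY1 (i j : 'I_f) : bideg i U_(rshift f j)%MM = (j == i).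
Proof. by rewrite /bideg !mnm1E eq_rshift eq_rlshift. Qed.

Lemma bideg_mon n k i : (k i <= n i)%N -> bideg i (mon n k) = n i.
Proof. by move=> kn; rewrite /bideg monX monY subnKC. Qed.

Lemma mon_bideg n (u : 'X_{1..f + f}) : (forall i, bideg i u = n i) ->
  u = mon n (fun i => u (lshift f i)).
Proof.
move=> un; apply/mnmP=> z; case: (split_ordP z) => i ->; rewrite ?monX ?monY //.
by rewrite -un /bideg addKn.
Qed.

Lemma mpolyX_mon n k :
  'X_[mon n k] = \prod_i (varX F i ^+ k i * varY F i ^+ (n i - k i)).
Proof.
rewrite mpolyXE_id big_split_ord big_split /=.
by congr (_ * _); apply: eq_bigr => i _; rewrite ?monX ?monY.
Qed.

Lemma multihomogX n (u : 'X_{1..f + f}) :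
  (forall i, bideg i u = n i) -> ('X_[u] : {mpoly F[f + f]}) \in multihomog n.
Proof. by move=> un; apply/forallP => i; rewrite dhomogX /= un. Qed.

Lemma multihomog_mon n k :
  (forall i, k i <= n i)%N -> ('X_[mon n k] : {mpoly F[f + f]}) \in multihomog n.
Proof. by move=> kn; apply: multihomogX => i; apply: bideg_mon. Qed.

Lemma multihomog_msupp n P (u : 'X_{1..f + f}) :
  P \in multihomog n -> u \in msupp P -> forall i, bideg i u = n i.
Proof. by move=> /forallP hP uP i; apply: (dhomogP _ _ _ (hP i)). Qed.

Lemma multihomogM n n' P Q : P \in multihomog n -> Q \in multihomog n' ->
  P * Q \in multihomog (fun i => n i + n' i)%N.
Proof.
by move=> /forallP hP /forallP hQ; apply/forallP=> i; apply: dhomogM.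
Qed.

Lemma multihomogP n c P Q : P \in multihomog n -> Q \in multihomog n ->
  c *: P + Q \in multihomog n.
Proof. by case: (@multihomog_submod F f n) => _; apply. Qed.

Lemma multihomog0 n : (0 : {mpoly F[f + f]}) \in multihomog n.
Proof. by case: (@multihomog_submod F f n). Qed.

Lemma multihomogZ n c P : P \in multihomog n -> c *: P \in multihomog n.
Proof. by move=> hP; rewrite -[_ *: _]addr0 multihomogP ?multihomog0. Qed.

Lemma multihomog_sum n (I : Type) (s : seq I) (E : I -> {mpoly F[f + f]}) :
  (forall i, E i \in multihomog n) -> \sum_(i <- s) E i \in multihomog n.
Proof.
move=> hE; elim/big_rec: _ => [|i P _ hP]; first exact: multihomog0.
by rewrite -[E i]scale1r multihomogP.
Qed.

(** Equivariance statements about V_n are thereby reduced to monomials. *)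
Lemma multihomog_linear_ext n (L L' : {mpoly F[f + f]} -> {mpoly F[f + f]}) :
    linear L -> linear L' ->
    (forall k, (forall i, k i <= n i)%N -> L 'X_[mon n k] = L' 'X_[mon n k]) ->
  forall P, P \in multihomog n -> L P = L' P.
Proof.
move=> linL linL' E P hP.
have L0 T : linear T -> T 0 = 0 :> {mpoly F[f + f]}.
  by move=> /(_ (- 1) 0 0); rewrite scaler0 add0r scaleN1r addNr.
rewrite (mpolyE P); have : {subset msupp P <= msupp P} by [].
elim: {1 3 4}(msupp P) => [|u s IHs] sP; first by rewrite !big_nil !L0.
rewrite !big_cons linL linL' IHs => [|v vs]; last by rewrite sP // inE vs orbT.
have un := multihomog_msupp hP (sP u (mem_head _ _)).
by rewrite (mon_bideg un) E // => i; rewrite -un /bideg leq_addr.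
Qed.

(** Membership in the monomial ideal generated by the X_i^(m_i + 1), expressed
through coefficients: this is how the jet of P at the point X = 0 is tested. *)
Definition vanishX m P := forall u : 'X_{1..f + f},
  (forall i, u (lshift f i) <= m i)%N -> P@_u = 0.

Lemma vanishXD m P Q : vanishX m P -> vanishX m Q -> vanishX m (P + Q).
Proof. by move=> hP hQ u um; rewrite mcoeffD hP ?hQ ?addr0. Qed.

Lemma vanishXN m P : vanishX m P -> vanishX m (- P).
Proof. by move=> hP u um; rewrite mcoeffN hP ?oppr0. Qed.

Lemma vanishXM m P Q : vanishX m Q -> vanishX m (P * Q).
Proof.
move=> hQ u um; rewrite mcoeffM big1 // => -[v w] /= /eqP E.
rewrite [X in _ * X]hQ ?mulr0 // => i.
have := congr1 (fun t : 'X_{1..f + f} => t (lshift f i)) E; rewrite mnmDE => Ei.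
by apply: leq_trans (um i); rewrite Ei leq_addl.
Qed.

Lemma vanishX_sum m (I : Type) (s : seq I) (E : I -> {mpoly F[f + f]}) :
  (forall i, vanishX m (E i)) -> vanishX m (\sum_(i <- s) E i).
Proof.
move=> hE; elim/big_rec: _ => [u _|i P _ hP]; first exact: mcoeff0.
exact: vanishXD.
Qed.

Lemma vanishX_pow m (i : 'I_f) e :
  (m i < e)%N -> vanishX m (varX F i ^+ e).
Proof.
move=> me u um; rewrite mcoeffXn; case: eqP => // E.
by have := um i; rewrite -E mulmnE mnm1E eqxx mul1n leqNgt me.
Qed.

Lemma vanishX_subX m P Q e :
  vanishX m (P - Q) -> vanishX m (P ^+ e - Q ^+ e).
Proof. by move=> hPQ; rewrite subrXX mulrC; apply: vanishXM. Qed.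

Lemma scale_prod (c : 'I_f -> F) (E : 'I_f -> {mpoly F[f + f]}) :
  \prod_i (c i *: E i) = (\prod_i c i) *: \prod_i E i.
Proof. exact: scaler_prod. Qed.

(** V_n is a tensor product of spaces of binary forms, and the coefficients of a
pure tensor are products of coefficients of its factors. *)
Lemma mcoeff_prod_mon n (w : 'I_f -> nat -> F) N j : (forall i, j i < N)%N ->
  (\prod_i \sum_(l < N) w i l *: (varX F i ^+ l * varY F i ^+ (n i - l)))@_(mon n j)
  = \prod_i w i (j i).
Proof.
move=> jN; rewrite bigA_distr_bigA /= raddf_sum /=.
pose j0 := [ffun i => Ordinal (jN i)].
rewrite (bigD1 j0) //= [X in _ + X]big1 ?addr0 => [|l lj]; last first.
  rewrite scale_prod mcoeffZ -mpolyX_mon mcoeffX mon_eqX.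
  case: forallP => [E|]; last by rewrite mulr0.
  case/eqP: lj; apply/ffunP=> i; apply: val_inj.
  by rewrite !ffunE /=; apply/eqP.
rewrite scale_prod mcoeffZ -mpolyX_mon mcoeffX mon_eqX.
rewrite (_ : [forall i, _]) ?mulr1; last by apply/forallP=> i; rewrite ffunE.
by apply: eq_bigr => i _; rewrite ffunE.
Qed.

End Monomials.

(** * The Hasse derivative and its Borel equivariance *)

(** Both sides are the trinomial coefficient (a + b + c)! / (a! b! c!). *)
Lemma bin_trinomial a b c :
  ('C(b + c, c) * 'C(a + (b + c), a) = 'C(a + (b + c), c) * 'C(a + b, a))%N.
Proof.
have fP n s : ('C(n + s, n) * (n`! * s`!) = (n + s)`!)%N.
  by rewrite -(bin_fact (leq_addr s n)) addKn.
have fbc : ('C(b + c, c) * (c`! * b`!) = (b + c)`!)%N by rewrite addnC fP.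
have fabc : ('C(a + (b + c), c) * (c`! * (a + b)`!) = (a + (b + c))`!)%N.
  by rewrite addnA [(_ + c)%N]addnC fP.
apply/eqP; rewrite -(@eqn_pmul2r (a`! * b`! * c`!)) ?muln_gt0 ?fact_gt0 //.
apply/eqP; transitivity (a + (b + c))`!.
  by rewrite -fP -fbc; ring.
by rewrite -fabc -[(a + b)`!]fP; ring.
Qed.

Section BorelMap.
Variables (p f : nat) (F : finFieldType).
Hypotheses (p_pr : prime p) (cardF : #|F| = (p ^ f)%N).
Variables (m r : 'I_f -> nat).
Hypotheses (m_lt : forall i, (m i < p)%N) (m_le_r : forall i, (m i <= r i)%N).
Implicit Types (k : 'I_f -> nat) (P Q : {mpoly F[f + f]}) (g : {'GL_2[F]}).

Lemma multihomog_ext n P Q : P \in multihomog n -> Q \in multihomog n ->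
  (forall k, (forall i, k i <= n i)%N -> P@_(mon n k) = Q@_(mon n k)) -> P = Q.
Proof.
move=> hP hQ E; apply/mpolyP=> u.
have [/forallP un|] := boolP [forall i, bideg i u == n i]; last first.
  case/forallPn=> i un; move/forallP/(_ i): hP => hP; move/forallP/(_ i): hQ => hQ.
  by rewrite (dhomog_nemf_coeff hP un) (dhomog_nemf_coeff hQ un).
have {}un i : bideg i u = n i by apply/eqP.
by rewrite (mon_bideg un) E // => i; rewrite -un /bideg leq_addr.
Qed.

(** The exponents a with a_i <= m_i. They are cut out of the functions to 'I_p,
which is possible since m_i < p, to get a finite type without dependent
codomains. *)
Definition smallexp := {a : {ffun 'I_f -> 'I_p} | [forall i, (a i <= m i)%N]}.

Definition expo (a : smallexp) (i : 'I_f) : nat := val a i.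

Lemma expo_le a i : (expo a i <= m i)%N.
Proof. exact: (forallP (valP a)). Qed.

Lemma expoP k : (forall i, k i <= m i)%N -> exists a : smallexp, expo a =1 k.
Proof.
move=> km; pose b := [ffun i => Ordinal (leq_ltn_trans (km i) (m_lt i))].
have bP : [forall i, (b i <= m i)%N] by apply/forallP=> i; rewrite ffunE; apply: km.
by exists (exist _ b bP) => i; rewrite /expo /= ffunE.
Qed.

Lemma expo_inj a b : expo a =1 expo b -> a = b.
Proof.
by move=> E; apply: val_inj; apply/ffunP=> i; apply: val_inj; apply: E.
Qed.

Definition hbin k : nat := \prod_i 'C(r i - k i, r i - m i).

(** The divided-power derivative of order r_i - m_i in each Y_i, on V_r. The terms
with some a_i > m_i are absent because they would have negative Y-degree. *)
Definition hasse P : {mpoly F[f + f]} :=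
  \sum_a ((hbin (expo a))%:R * P@_(mon r (expo a))) *: 'X_[mon m (expo a)].

Lemma hasse_linear : linear hasse.
Proof.
move=> c P Q; rewrite /hasse scaler_sumr -big_split; apply: eq_bigr => a _ /=.
by rewrite mcoeffD mcoeffZ scalerA -scalerDl; congr (_ *: _); ring.
Qed.

HB.instance Definition _ :=
  GRing.isLinear.Build F {mpoly F[f + f]} {mpoly F[f + f]} *:%R hasse hasse_linear.

Lemma hasse_homog P : hasse P \in multihomog m.
Proof. by apply: multihomog_sum => a; apply/multihomogZ/multihomog_mon/expo_le. Qed.

Lemma mcoeff_hasse P k : (forall i, k i <= m i)%N ->
  (hasse P)@_(mon m k) = (hbin k)%:R * P@_(mon r k).
Proof.
move=> /expoP [a ak]; rewrite -(eq_mon (fun=> erefl) ak) -(eq_mon (fun=> erefl) ak).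
rewrite (_ : hbin k = hbin (expo a)); last first.
  by apply: eq_bigr => i _; rewrite ak.
rewrite /hasse raddf_sum (bigD1 a) //= [X in _ + X]big1 ?addr0 => [|b ba].
  by rewrite mcoeffZ mcoeffX eqxx mulr1.
rewrite mcoeffZ mcoeffX mon_eqX; case: forallP => [E|]; last by rewrite mulr0.
by case/eqP: ba; apply: expo_inj => i; apply/eqP/E.
Qed.

Lemma hasse_vanishX P : vanishX m P -> hasse P = 0.
Proof.
move=> hP; rewrite /hasse big1 // => a _.
by rewrite hP ?mulr0 ?scale0r // => i; rewrite monX expo_le.
Qed.

Lemma hbin_gt k i : (k i <= r i)%N -> (m i < k i)%N -> hbin k = 0%N.
Proof.
move=> kr mk; rewrite /hbin (bigD1 i) //= bin_small ?mul0n //.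
by move: (m_le_r i); lia.
Qed.

Lemma hasse_mon k : (forall i, k i <= r i)%N ->
  hasse 'X_[mon r k] = (hbin k)%:R *: 'X_[mon m k].
Proof.
move=> kr; have [/forallP km|/forallPn [i]] := boolP [forall i, (k i <= m i)%N].
  apply: (multihomog_ext (hasse_homog _)) => [|j jm].
    exact/multihomogZ/multihomog_mon.
  rewrite mcoeff_hasse // mcoeffZ !mcoeffX !mon_eqX.
  case: forallP => [E|]; last by rewrite !mulr0.
  by congr (_%:R * _); apply: eq_bigr => i _; rewrite (eqP (E i)).
rewrite -ltnNge => mk; rewrite (hbin_gt (kr i) mk) scale0r; apply: hasse_vanishX.
move=> u um; rewrite mcoeffX; case: eqP => // E.
by have := um i; rewrite -E monX leqNgt mk.
Qed.

(** The substitution X |-> a X, Y |-> b X + d Y on one factor, with the sum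
extended to all l < N so that the range does not depend on the factor. *)
Lemma binary_power_expand (X Y : {mpoly F[f + f]}) (a b d : F)
    (n k N : nat) :
    (k <= n)%N -> (n < N)%N ->
  (a *: X) ^+ k * (b *: X + d *: Y) ^+ (n - k) =
  \sum_(l < N) (if (k <= l)%N
                then a ^+ k * b ^+ (l - k) * d ^+ (n - l) *+ 'C(n - k, l - k)
                else 0) *: (X ^+ l * Y ^+ (n - l)).
Proof.
move=> kn nN; pose E l : {mpoly F[f + f]} := (if (k <= l)%N
                then a ^+ k * b ^+ (l - k) * d ^+ (n - l) *+ 'C(n - k, l - k)
                else 0) *: (X ^+ l * Y ^+ (n - l)).
rewrite -(big_mkord xpredT E) (@big_cat_nat _ _ _ k) //=; last exact/ltnW/(leq_ltn_trans kn).
rewrite big_nat_cond big1 ?add0r => [|l /andP [/andP [_ lk] _]]; last first.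
  by rewrite /E leqNgt lk scale0r.
rewrite (_ : \sum_(k <= l < N) E l = \sum_(0 <= l < N - k) E (l + k)%N); last first.
  by rewrite -{1}[k]add0n big_addn.
rewrite (@big_cat_nat _ _ _ (n - k).+1) //=; last by lia.
rewrite [X in _ = _ + X]big_nat_cond [X in _ = _ + X]big1 ?addr0; last first.
  move=> l /andP [/andP [nl _] _].
  by rewrite /E addnK bin_small // mulr0n if_same scale0r.
rewrite big_mkord addrC exprDn mulr_sumr; apply: eq_bigr => l _.
rewrite /E leq_addl addnK -subnDA [(k + l)%N]addnC !exprZn.
rewrite -!mul_mpolyC exprD raddfMn /= !mpolyCM; ring.
Qed.

Definition upper_coef g n k (i : 'I_f) (l : nat) : F :=
  if (k i <= l)%N then
    (gl2_mx g 0 0 ^+ (p ^ i)) ^+ k i * (gl2_mx g 0 1 ^+ (p ^ i)) ^+ (l - k i)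
      * (gl2_mx g 1 1 ^+ (p ^ i)) ^+ (n i - l) *+ 'C(n i - k i, l - k i)
  else 0.

Lemma mcoeff_upper_act g n k (j : 'I_f -> nat) : gl2_mx g 1 0 = 0 ->
    (forall i, k i <= n i)%N -> (forall i, j i <= n i)%N ->
  (poly_act p g 'X_[mon n k])@_(mon n j) = \prod_i upper_coef g n k i (j i).
Proof.
move=> g10 kn jn; pose N := (\max_i n i).+1.
have nN i : (n i < N)%N by rewrite ltnS; apply: leq_bigmax.
rewrite -(@mcoeff_prod_mon F f n (upper_coef g n k) N); last first.
  by move=> i; apply: leq_ltn_trans (nN i).
congr (_@__); rewrite mpolyX_mon rmorph_prod; apply: eq_bigr => i _ /=.
rewrite rmorphM !rmorphXn /= poly_actX poly_actY g10.
rewrite expr0n expn_eq0 eqn0Ngt prime_gt0 //= scale0r addr0.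
exact: binary_power_expand.
Qed.

(** On each factor the equality of coefficients is the identity
C(r-j, r-m) C(r-k, j-k) = C(r-k, r-m) C(m-k, j-k), where k and j are the
X-exponents before and after the substitution. *)
Lemma hasse_upper_act g P : gl2_mx g 1 0 = 0 -> P \in multihomog r ->
  hasse (poly_act p g P) =
  (\prod_(i < f) gl2_mx g 1 1 ^+ ((r i - m i) * p ^ i)) *: poly_act p g (hasse P).
Proof.
move=> g10; move: P; apply: multihomog_linear_ext => [c P Q|c P Q|k kr].
- by rewrite (linearP (poly_act p g)) (linearP hasse).
- by rewrite (linearP hasse) (linearP (poly_act p g)) scalerDr !scalerA mulrC.
rewrite hasse_mon // linearZ /=.
have [/forallP km|/forallPn [i]] := boolP [forall i, (k i <= m i)%N]; last first.
  rewrite -ltnNge => mk; rewrite (hbin_gt (kr i) mk) scale0r scaler0.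
  apply: (multihomog_ext (hasse_homog _)) => [|j jm]; first exact: multihomog0.
  rewrite mcoeff_hasse // mcoeff_upper_act // => [|l]; last exact: leq_trans (m_le_r l).
  rewrite (bigD1 i) //= /upper_coef leqNgt (leq_ltn_trans (jm i) mk).
  by rewrite mul0r mulr0 mcoeff0.
apply: (multihomog_ext (hasse_homog _)) => [|j jm].
  do 2!apply: multihomogZ; apply: (@multihomog_stable p f F p_pr cardF).
  exact: multihomog_mon.
have jr l : (j l <= r l)%N by apply: leq_trans (m_le_r l).
rewrite mcoeff_hasse // !mcoeffZ !mcoeff_upper_act //.
rewrite /hbin !natr_prod -!big_split; apply: eq_bigr => i _ /=.
rewrite /upper_coef; case: leqP => [kj|]; last by rewrite !mulr0.
have := bin_trinomial (j i - k i) (m i - j i) (r i - m i).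
rewrite (_ : _ + (r i - m i) = r i - j i)%N; last by move: (jm i) (m_le_r i); lia.
rewrite (_ : _ + (r i - j i) = r i - k i)%N; last by move: (jr i); lia.
rewrite (_ : j i - k i + _ = m i - k i)%N; last by move: (jm i); lia.
move=> /(congr1 (fun n => n%:R : F)); rewrite !natrM => E.
rewrite [((r i - m i) * _)%N]mulnC exprM.
have -> : (gl2_mx g 1 1 ^+ (p ^ i)) ^+ (r i - j i) =
    (gl2_mx g 1 1 ^+ (p ^ i)) ^+ (r i - m i)
    * (gl2_mx g 1 1 ^+ (p ^ i)) ^+ (m i - j i).
  by rewrite -exprD; congr (_ ^+ _); move: (jm i) (m_le_r i); lia.
rewrite -!(mulr_natr (_ * _)).
move: E; move: ('C(_, _)%:R) => A; move: ('C(_, _)%:R) => B.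
move: ('C(_, _)%:R) => C; move: ('C(_, _)%:R) => D E.
ring: E.
Qed.

(** * The theta ideal and the Dickson forms *)

Definition theta_gen (i : 'I_f) : {mpoly F[f + f]} := theta F p i ^+ (m i).+1.

(** With A = X_i Y_(i-1)^p, theta_i - A is a multiple of X_(i-1)^p, hence vanishes
to order m_(i-1) + 1 <= p, while A^(m_i + 1) is a multiple of X_i^(m_i + 1). *)
Lemma theta_gen_vanishX i : vanishX m (theta_gen i).
Proof.
set A := varX F i * varY F (ord_pred i) ^+ p.
rewrite -[theta_gen i](subrK (A ^+ (m i).+1)); apply: vanishXD.
  apply: vanishX_subX; rewrite /theta -/A addrAC subrr add0r.
  exact/vanishXN/vanishXM/vanishX_pow.
by rewrite exprMn mulrC; apply/vanishXM/vanishX_pow.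
Qed.

Lemma in_ideal_vanishX P : in_ideal theta_gen P -> vanishX m P.
Proof.
by case=> h ->; apply: vanishX_sum => i; apply/vanishXM/theta_gen_vanishX.
Qed.

Lemma in_ideal_act g P : in_ideal theta_gen P -> in_ideal theta_gen (poly_act p g P).
Proof.
move=> [h ->].
exists (fun i : 'I_f =>
  (\det (gl2_mx g) ^+ (p ^ i)) ^+ (m i).+1 *: poly_act p g (h i)).
rewrite raddf_sum; apply: eq_bigr => i _ /=.
by rewrite rmorphM /theta_gen rmorphXn /= (theta_act p_pr cardF) exprZn -scalerAr -scalerAl.
Qed.

Lemma hasse_act_in_ideal g P : in_ideal theta_gen P -> hasse (poly_act p g P) = 0.
Proof. by move/(in_ideal_act g)/in_ideal_vanishX/hasse_vanishX. Qed.

Lemma in_idealD P Q :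
  in_ideal theta_gen P -> in_ideal theta_gen Q -> in_ideal theta_gen (P + Q).
Proof.
move=> [h ->] [k ->]; exists (fun i => h i + k i).
by rewrite -big_split; apply: eq_bigr => i _; rewrite mulrDl.
Qed.

Lemma in_idealZ c P : in_ideal theta_gen P -> in_ideal theta_gen (c *: P).
Proof.
move=> [h ->]; exists (fun i => c *: h i).
by rewrite scaler_sumr; apply: eq_bigr => i _; rewrite scalerAl.
Qed.

Lemma in_ideal0 : in_ideal theta_gen 0.
Proof. by exists (fun=> 0); rewrite big1 // => i _; rewrite mul0r. Qed.

Lemma in_ideal_gen i Q : in_ideal theta_gen (Q * theta_gen i).
Proof.
exists (fun j : 'I_f => if j == i then Q else 0).
rewrite (bigD1 i) //= eqxx big1 ?addr0 // => j /negPf ->.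
by rewrite mul0r.
Qed.

(** The product over l in F_q of the forms Y_i - l^(p^i) X_i: it vanishes
at every rational point other than X = 0. *)
Definition dickson (i : 'I_f) : {mpoly F[f + f]} :=
  varY F i ^+ (p ^ f) - varY F i * varX F i ^+ (p ^ f).-1.

(** If m_i + 1 <= q - 1 the congruence already holds for [dickson] itself, modulo
X_i^(q - 1). Otherwise m_i + 1 = p = q, and the Frobenius pushes the error
term to X_i^(p (q - 1)). *)
Lemma dickson_pow i :
  vanishX m (dickson i ^+ (m i).+1 - varY F i ^+ (p ^ f * (m i).+1)).
Proof.
have p_gt1 := prime_gt1 p_pr.
have pq : (p <= p ^ f)%N.
  rewrite -{1}[p]expn1; apply: leq_pexp2l; first exact: ltnW.
  exact: leq_ltn_trans (leq0n i) (ltn_ord i).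
have [lt|ge] := ltnP (m i) (p ^ f).-1.
  rewrite exprM; apply: vanishX_subX; rewrite /dickson addrAC subrr add0r.
  exact/vanishXN/vanishXM/vanishX_pow.
have mp : (m i).+1 = p by move: (m_lt i); lia.
have FP (x y : {mpoly F[f + f]}) : (x + y) ^+ p = x ^+ p + y ^+ p.
  by have := frobD p_pr x y 1 (pchar_mpoly p_pr cardF); rewrite expn1.
rewrite mp /dickson FP -exprM addrAC subrr add0r -mulNr exprMn -exprM.
by apply/vanishXM/vanishX_pow; move: (m_lt i); nia.
Qed.

Lemma powD_mod (x y : {mpoly F[f + f]}) e : exists h, (x + y) ^+ e = y ^+ e + x * h.
Proof.
have := subrXX (x + y) y e; rewrite addrK => E; eexists.
by apply: (canRL (subrKC _)); exact: E.
Qed.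

(** A matrix outside the Borel subgroup moves X = 0 to another rational point, so
one of the linear factors of [dickson] becomes a multiple of X_i. Computing
modulo X_i, the image is (d^q - d c^(q-1)) Y_i^q, which is zero. *)
Lemma dickson_act g i : gl2_mx g 1 0 != 0 ->
  exists h, poly_act p g (dickson i) = varX F i * h.
Proof.
move=> g10; have p_gt1 := prime_gt1 p_pr.
have q_gt0 : (0 < p ^ f)%N by rewrite expn_gt0 prime_gt0.
rewrite raddfB /= rmorphM !rmorphXn /= poly_actX poly_actY.
set a := gl2_mx g 0 0 ^+ _; set b := gl2_mx g 0 1 ^+ _.
set c := gl2_mx g 1 0 ^+ _; set d := gl2_mx g 1 1 ^+ _.
have c1 : c ^+ (p ^ f).-1 = 1.
  apply: (mulfI (_ : c != 0)); first by rewrite expf_neq0.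
  by rewrite -exprS prednK // -cardF expf_card mulr1.
have dq : d ^+ (p ^ f) = d by rewrite -cardF expf_card.
have [h1 ->] := powD_mod (a *: varX F i) (c *: varY F i) (p ^ f).-1.
have [h2 ->] := powD_mod (b *: varX F i) (d *: varY F i) (p ^ f).
rewrite exprZn dq.
have -> : varY F i ^+ (p ^ f) = varY F i * varY F i ^+ (p ^ f).-1.
  by rewrite -exprS prednK.
rewrite exprZn c1 scale1r.
set Y := varY F i; set X := varX F i; move: (Y ^+ _) => Z.
exists (b *: h2 - b *: Z - (b *: X + d *: Y) * (a *: h1)).
rewrite -!mul_mpolyC; ring.
Qed.

(** * Spanning V_r modulo the theta ideal *)

Hypothesis r_ge : forall i, ((m i).+1 * (p ^ f).+1 <= (r i).+1)%N.

(** The multidegree of prod theta_i^a_i. *)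
Definition thdeg a (i : 'I_f) : nat := (a i + p * a (ordS i))%N.

Definition thpow a : {mpoly F[f + f]} := \prod_i theta F p i ^+ a i.

Definition bump a (i j : 'I_f) : nat := (a j + (j == i))%N.

Lemma thpow_bump a i : thpow (bump a i) = thpow a * theta F p i.
Proof.
have E : theta F p i = \prod_j theta F p j ^+ (j == i).
  rewrite (bigD1 i) //.
  rewrite big1; last by move=> j /negPf ->; rewrite expr0.
  rewrite eqxx.
  by rewrite expr1 /= mulr1.
by rewrite [in RHS]E /thpow -big_split; apply: eq_bigr => j _; rewrite exprD.
Qed.

Lemma theta_homog i :
  theta F p i \in multihomog (fun j : 'I_f => (i == j) + p * (ord_pred i == j))%N.
Proof.
have E (Z W : 'I_f -> 'I_(f + f)) :
    (forall a j : 'I_f, bideg j U_(Z a)%MM = (a == j)) ->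
    (forall a j : 'I_f, bideg j U_(W a)%MM = (a == j)) ->
    ('X_(Z i) * 'X_(W (ord_pred i)) ^+ p : {mpoly F[f + f]})
      \in multihomog (fun j : 'I_f => (i == j) + p * (ord_pred i == j))%N.
  move=> hZ hW; apply/forallP=> j; rewrite dhomogM ?dhomogX /= ?hZ //.
  by rewrite mulnC; apply: dhomogMn; rewrite dhomogX /= hW.
rewrite /theta -scaleN1r addrC; apply: multihomogP.
  exact: (E _ _ (fun a j : 'I_f => bidegY1 j a) (fun a j : 'I_f => bidegX1 j a)).
exact: (E _ _ (fun a j : 'I_f => bidegX1 j a) (fun a j : 'I_f => bidegY1 j a)).
Qed.

Lemma multihomog_eq n n' P : n =1 n' -> P \in multihomog n -> P \in multihomog n'.
Proof. by move=> E /forallP hP; apply/forallP=> i; rewrite -E. Qed.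

Lemma eq_ord_pred (i l : 'I_f) : (ord_pred i == l) = (i == ordS l).
Proof. exact: (can2_eq (@ord_predK f) (@ordSK f)). Qed.

Lemma thpow_homog a : thpow a \in multihomog (thdeg a).
Proof.
apply/forallP=> j.
have -> : thdeg a j = (\sum_i ((i == j) + p * (ord_pred i == j)) * a i)%N.
  rewrite (eq_bigr (fun i : 'I_f => (i == j) * a i + p * (ord_pred i == j) * a i)%N).
    rewrite big_split /= (bigD1 j) //= [X in (_ = _ + X + _)%N]big1 => [|i /negPf -> //].
    rewrite [X in (_ + X)%N](bigD1 (ordS j)) //= [X in (_ = _ + (_ + X))%N]big1.
      by rewrite ordSK !eqxx muln1 mul1n !addn0.
    by move=> i /negPf E; rewrite eq_ord_pred E muln0.
  by move=> i _; rewrite mulnDl.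
apply: (big_rec2 (fun d Q => Q \is d.-homog for (bideg j))) => [|i d Q _ hQ].
  exact: dhomog1.
by apply: dhomogM => //; apply: dhomogMn; move/forallP: (theta_homog i); apply.
Qed.

(** Iterating the cyclic successor from i0 reaches every index. *)
Lemma cyclic_ind (Q : 'I_f -> Prop) i0 :
  (forall i, Q (ord_pred i) -> Q i) -> Q i0 -> forall i, Q i.
Proof.
move=> step Q0 i.
have Qn n : Q (iter n (@ordS f) i0).
  by elim: n => //= n IHn; apply: step; rewrite ordSK.
have vn n : val (iter n (@ordS f) i0) = ((i0 + n) %% f)%N.
  elim: n => [|n IHn]; first by rewrite addn0 modn_small.
  by rewrite /= IHn -addn1 modnDml addn1 addnS.
rewrite (_ : i = iter (i + (f - i0)) (@ordS f) i0) //; apply: val_inj.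
rewrite vn addnCA [(i0 + _)%N]subnKC; last exact: ltnW.
by rewrite modnDr modn_small.
Qed.

(** The q + 1 monomials of given multidegree that admit no carry: [Some b] has
X-exponents b, with all b_i < p, and [None] stands for prod X_i^n_i. *)
Definition normal_index := option {ffun 'I_f -> 'I_p}.

Definition normal_exp n (t : normal_index) (i : 'I_f) : nat :=
  if t is Some b then b i else n i.

(** This is where the lower bound on r enters: the cofactor of theta^a in V_r has
degree at least p in every pair of variables, so that carries are blocked only
at a normal monomial. For f >= 2 the bound follows from p^2 <= q; for f = 1 it
is attained when a = m and r is minimal. *)
Lemma thdeg_le a i : (forall i, a i <= m i)%N -> (thdeg a i + p <= r i)%N.
Proof.
move=> am; rewrite /thdeg; have p_gt1 := prime_gt1 p_pr.
have := r_ge i; have := am i; have := am (ordS i); have := m_lt (ordS i).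
have [f1|f_gt1] := leqP f 1.
  have f1' : f = 1%N by have := ltn_ord i; lia.
  have -> : ordS i = i.
    by apply: ord_inj; have := ltn_ord (ordS i); have := ltn_ord i; lia.
  by rewrite f1' expn1; nia.
have : (p * p <= p ^ f)%N by rewrite mulnn leq_pexp2l // ltnW.
by nia.
Qed.

Definition cofdeg a (i : 'I_f) : nat := (r i - thdeg a i)%N.

Definition span_gen (x : smallexp * normal_index) : {mpoly F[f + f]} :=
  thpow (expo x.1) * 'X_[mon (cofdeg (expo x.1)) (normal_exp (cofdeg (expo x.1)) x.2)].

Definition span_comb (c : {ffun smallexp * normal_index -> F^o}) : {mpoly F[f + f]} :=
  \sum_x c x *: span_gen x.

Lemma span_comb_linear : linear span_comb.
Proof.
move=> a c d; rewrite /span_comb scaler_sumr -big_split; apply: eq_bigr => x _ /=.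
by rewrite !ffunE scalerDl scalerA.
Qed.

HB.instance Definition _ :=
  GRing.isLinear.Build F {ffun smallexp * normal_index -> F^o} {mpoly F[f + f]} *:%R
    span_comb span_comb_linear.

Lemma span_gen_homog x : span_gen x \in multihomog r.
Proof.
have am := expo_le x.1; have dr i := thdeg_le i am.
apply: (@multihomog_eq (fun i => thdeg (expo x.1) i + cofdeg (expo x.1) i)%N).
  by move=> i; rewrite /cofdeg subnKC //; move: (dr i); lia.
apply: multihomogM; first exact: thpow_homog.
apply: multihomog_mon => i; case: (x.2) => [b|] //=.
by rewrite /cofdeg; move: (dr i) (ltn_ord (b i)); lia.
Qed.

(** The cofactors in the ideal range over the whole polynomial ring, so no degree
has to be tracked for them. *)
Definition spanned P := exists c, in_ideal theta_gen (P - span_comb c).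

Lemma spannedP c P Q : spanned P -> spanned Q -> spanned (c *: P + Q).
Proof.
move=> [u hu] [v hv]; exists (c *: u + v).
rewrite linearP opprD addrACA -scalerBr; apply: in_idealD => //.
exact: in_idealZ.
Qed.

Lemma spanned0 : spanned 0.
Proof. by exists 0; rewrite raddf0 subr0; apply: in_ideal0. Qed.

Lemma spanned_theta a i Q : (m i < a i)%N -> spanned (thpow a * Q).
Proof.
move=> ma; exists 0; rewrite raddf0 subr0 /thpow (bigD1 i) //=.
rewrite [X in X * _ * _](_ : _ = theta_gen i * theta F p i ^+ (a i - (m i).+1)).
  by rewrite -!mulrA [theta_gen i * _]mulrC; apply: in_ideal_gen.
by rewrite /theta_gen -exprD subnKC.
Qed.

Lemma spanned_gen x : spanned (span_gen x).
Proof.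
exists [ffun y => (y == x)%:R]; rewrite /span_comb (bigD1 x) //= big1.
  by rewrite ffunE eqxx scale1r addr0 subrr; apply: in_ideal0.
by move=> y /negPf yx; rewrite ffunE yx scale0r.
Qed.

Lemma bidegMn (u : 'X_{1..f + f}) e i : bideg i (u *+ e)%MM = (bideg i u * e)%N.
Proof. by rewrite /bideg !mulmnE mulnDl. Qed.

(** If some X-exponent is at least p, the blocked carry forces the next
Y-exponent to vanish, so the next X-exponent is the full degree, which is again
at least p. Going round the cycle, no Y is left. *)
Lemma terminal_spanned a (u : 'X_{1..f + f}) :
    (forall i, a i <= m i)%N -> (forall i, thdeg a i + bideg i u = r i)%N ->
    (forall i, (p <= u (lshift f (ord_pred i)))%N -> u (rshift f i) = 0%N) ->
  spanned (thpow a * 'X_[u]).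
Proof.
move=> am deg term; have [b ba] := expoP am.
have du i : bideg i u = cofdeg (expo b) i.
  by rewrite /cofdeg /thdeg !ba -(deg i) addKn.
have -> : thpow a = thpow (expo b) by apply: eq_bigr => i _; rewrite ba.
suff [t Et] : exists t, (fun i => u (lshift f i)) =1 normal_exp (cofdeg (expo b)) t.
  rewrite (mon_bideg du) (eq_mon (fun=> erefl) Et); exact: (spanned_gen (b, t)).
have [/forallP small|/forallPn [i0]] := boolP [forall i, (u (lshift f i) < p)%N].
  by exists (Some [ffun i => Ordinal (small i)]) => i /=; rewrite ffunE.
rewrite -leqNgt => big0; exists None => i /=; rewrite -du.
suff [Y0 _] : u (rshift f i) = 0%N /\ (p <= u (lshift f i))%N.
  by rewrite /bideg Y0 addn0.
have dp (j : 'I_f) : (p <= bideg j u)%N.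
  by move: (thdeg_le j am) (deg j); lia.
have big (j : 'I_f) : (p <= u (lshift f j))%N.
  apply: (@cyclic_ind (fun j : 'I_f => p <= u (lshift f j))%N i0) => // l /term Y0.
  by have := dp l; rewrite /bideg Y0 addn0.
by rewrite term.
Qed.

Lemma sum_pred1 (l : 'I_f) (E : 'I_f -> nat) c :
  (\sum_i (E i + c * (i == l)) = \sum_i E i + c)%N.
Proof.
rewrite big_split /= [X in (_ + X)%N](bigD1 l) //= eqxx muln1.
by rewrite [X in (c + X)%N]big1 ?addn0 // => i /negPf ->; rewrite muln0.
Qed.

(** One carry replaces theta^a u by theta^a v - theta^(a + e_i) u'. The first term
has a smaller sum of X-exponents, the second a larger a; both decrease in the
lexicographic order used for the induction, which stops once some a_i
exceeds m_i, as theta^a is then in the ideal. *)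
Lemma monomial_spanned a (u : 'X_{1..f + f}) :
  (forall i, thdeg a i + bideg i u = r i)%N -> spanned (thpow a * 'X_[u]).
Proof.
have [N] := ubnP (\sum_i ((m i).+1 - a i))%N.
elim: N => // N IHN in a u *; rewrite ltnS => leN.
have [M] := ubnP (\sum_i u (lshift f i))%N.
elim: M => // M IHM in u *; rewrite ltnS => leM deg.
have [/forallP am|/forallPn [i]] := boolP [forall i, (a i <= m i)%N]; last first.
  by rewrite -ltnNge; apply: spanned_theta.
have [/existsP [i /andP [pu Yu]]|] :=
  boolP [exists i, (p <= u (lshift f (ord_pred i)))%N && (0 < u (rshift f i))%N];
  last first.
  move/existsPn=> term; apply: terminal_spanned => // i pu.
  by have := term i; rewrite pu /= -eqn0Ngt => /eqP.
pose w := (U_(lshift f (ord_pred i)) *+ p + U_(rshift f i))%MM.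
pose u' := (u - w)%MM.
have uE : u = (u' + w)%MM.
  rewrite submK //; apply/mnm_lepP=> z; rewrite mnmDE mulmnE !mnm1E.
  case: (split_ordP z) => j ->; rewrite ?eq_lshift ?eq_rshift ?eq_lrshift ?eq_rlshift.
    by case: eqP => [<-|]; rewrite ?mul1n ?addn0.
  by case: eqP => [<-|]; rewrite ?mul0n ?add0n.
pose v := (u' + (U_(lshift f i) + U_(rshift f (ord_pred i)) *+ p))%MM.
have wE : 'X_[u] = 'X_[v] - theta F p i * 'X_[u'] :> {mpoly F[f + f]}.
  rewrite uE /v !mpolyXD -!mpolyXn /theta /varX /varY; ring.
rewrite wE mulrBr mulrA -thpow_bump addrC -scaleN1r; apply: spannedP.
  apply: IHN => [|j].
    apply: leq_trans leN; rewrite [X in (_ < X)%N](bigD1 i) //= (bigD1 i) //=.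
    rewrite /bump eqxx -addSn leq_add //; first by move: (am i); lia.
    by apply: leq_sum => j _; rewrite leq_sub2l // leq_addr.
  rewrite -(deg j) uE !bidegD bidegMn bidegX1 bidegY1 /thdeg /bump eq_ord_pred.
  rewrite [j == i]eq_sym [ordS j == i]eq_sym; ring.
apply: IHM => [|j].
  apply: leq_trans leM; rewrite uE.
  rewrite (eq_bigr (fun j : 'I_f => u' (lshift f j) + 1 * (j == i))%N).
    rewrite [X in (_ < X)%N](eq_bigr (fun j : 'I_f =>
      u' (lshift f j) + p * (j == ord_pred i))%N).
      by rewrite !sum_pred1 ltn_add2l prime_gt1.
    move=> j _ /=; rewrite !mnmDE mulmnE !mnm1E eq_lshift eq_rlshift.
    by rewrite [j == _]eq_sym addn0 mulnC.
  move=> j _ /=; rewrite !mnmDE mulmnE !mnm1E eq_lshift eq_rlshift.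
  by rewrite [j == _]eq_sym mul0n addn0 mul1n.
by rewrite -(deg j) uE !bidegD !bidegMn !bidegX1 !bidegY1; ring.
Qed.

Lemma homog_spanned P : P \in multihomog r -> spanned P.
Proof.
move=> hP; rewrite (mpolyE P); have : {subset msupp P <= msupp P} by [].
elim: {1 3}(msupp P) => [|u s IHs] sP; first by rewrite big_nil; apply: spanned0.
rewrite big_cons; apply: spannedP; last first.
  by apply: IHs => v vs; rewrite sP // inE vs orbT.
have -> : 'X_[u] = thpow (fun=> 0%N) * 'X_[u] :> {mpoly F[f + f]}.
  by rewrite /thpow big1 ?mul1r // => i _; rewrite expr0.
apply: monomial_spanned => i; rewrite /thdeg muln0 add0n.
exact: multihomog_msupp hP (sP u (mem_head _ _)) i.
Qed.

(** * Polynomials with prescribed jets *)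

Hypothesis bin_ndvd : forall i, ~~ (p %| 'C(r i, m i))%N.

Lemma prime_ndvd_fact n : (n < p)%N -> ~~ (p %| n`!)%N.
Proof.
elim: n => [|n IHn] np; first by rewrite dvdn1 gtn_eqF ?prime_gt1.
by rewrite factS Euclid_dvdM // negb_or gtnNdvd // IHn // ltnW.
Qed.

(** From C(r-a, r-m) C(r, a) = C(r, m) C(m, a): the right-hand side is prime to
p, by hypothesis and because m < p. *)
Lemma hbin_neq0 (a : smallexp) : (hbin (expo a))%:R != 0 :> F.
Proof.
rewrite -(dvdn_pcharf (pchar_F p_pr cardF)) /hbin.
elim/big_rec: _ => [|i n _ ndvd]; first by rewrite dvdn1 gtn_eqF ?prime_gt1.
rewrite Euclid_dvdM // negb_or ndvd andbT; apply/negP => dvd.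
have ai := expo_le a i; have mri := m_le_r i.
have := bin_trinomial (expo a i) (m i - expo a i) (r i - m i).
rewrite (_ : m i - expo a i + (r i - m i) = r i - expo a i)%N; last by lia.
rewrite (subnKC ai) subnKC; last exact: leq_trans mri.
rewrite bin_sub // => /(congr1 (dvdn p)).
rewrite (dvdn_mulr _ dvd) Euclid_dvdM // (negPf (bin_ndvd i)) /= => /esym dvdm.
have /negP := prime_ndvd_fact (m_lt i); apply.
by rewrite -(bin_fact ai) dvdn_mulr.
Qed.

Lemma multihomog_exp n P e :
  P \in multihomog n -> P ^+ e \in multihomog (fun i => n i * e)%N.
Proof. by move=> /forallP hP; apply/forallP=> i; apply: dhomogMn. Qed.

Lemma dickson_homog i :
  dickson i \in multihomog (fun l : 'I_f => (i == l) * p ^ f)%N.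
Proof.
have q_gt0 : (0 < p ^ f)%N by rewrite expn_gt0 prime_gt0.
rewrite /dickson addrC -scaleN1r; apply: multihomogP; apply/forallP=> l; last first.
  by apply: dhomogMn; rewrite dhomogX /= bidegY1.
rewrite -{2}(prednK q_gt0) mulnS; apply: dhomogM.
  by rewrite dhomogX /= bidegY1.
by apply: dhomogMn; rewrite dhomogX /= bidegX1.
Qed.

Section Localize.
Variables (i0 : 'I_f) (a : smallexp).

(** The degree left for the monomial factor of [local_poly]. A Dickson power at the
single index i0 suffices, since vanishing to order m_i0 + 1 in X_i0 kills the
jet. *)
Definition local_deg (l : 'I_f) : nat := (r l - (i0 == l) * (p ^ f * (m i0).+1))%N.

Definition local_poly : {mpoly F[f + f]} :=
  dickson i0 ^+ (m i0).+1 * 'X_[mon local_deg (expo a)].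

Lemma local_deg_le l :
  (expo a l <= local_deg l)%N /\ ((i0 == l) * (p ^ f * (m i0).+1) <= r l)%N.
Proof.
rewrite /local_deg; have := expo_le a l; have := r_ge l; have := m_le_r l.
by case: eqP => [->|_]; rewrite ?mul1n ?mul0n; nia.
Qed.

Lemma local_poly_homog : local_poly \in multihomog r.
Proof.
apply: (@multihomog_eq (fun l => (i0 == l) * p ^ f * (m i0).+1 + local_deg l)%N).
  by move=> l; rewrite -mulnA subnKC //; case: (local_deg_le l).
apply: multihomogM; first exact/multihomog_exp/dickson_homog.
by apply: multihomog_mon => l; case: (local_deg_le l).
Qed.

Lemma hasse_local_poly :
  hasse local_poly = (hbin (expo a))%:R *: 'X_[mon m (expo a)].
Proof.
have ar i : (expo a i <= r i)%N := leq_trans (expo_le a i) (m_le_r i).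
rewrite -(hasse_mon ar) -[LHS](subrK (hasse 'X_[mon r (expo a)])) -raddfB /=.
rewrite hasse_vanishX ?add0r //.
have -> : 'X_[mon r (expo a)]
    = varY F i0 ^+ (p ^ f * (m i0).+1) * 'X_[mon local_deg (expo a)].
  rewrite mpolyXn -mpolyXD; congr ('X_[_]); apply/mnmP=> z.
  rewrite mnmDE mulmnE mnm1E; case: (split_ordP z) => l ->.
    by rewrite !monX eq_rlshift.
  rewrite !monY eq_rshift; case: (local_deg_le l) => le H.
  by rewrite addnBA // subnKC.
by rewrite -mulrBl mulrC; apply/vanishXM/dickson_pow.
Qed.

Lemma hasse_act_local_poly g : gl2_mx g 1 0 != 0 ->
  hasse (poly_act p g local_poly) = 0.
Proof.
move=> g10; apply: hasse_vanishX; rewrite rmorphM rmorphXn /=.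
have [h ->] := dickson_act i0 g10.
by rewrite exprMn -mulrA mulrC; apply/vanishXM/vanishX_pow.
Qed.

End Localize.

(** Representatives of the right cosets of the Borel subgroup. A coset is
determined by the bottom row up to scalars, that is by a point of the projective
line: [Some x] is the row (1, x) and [None] the row (0, 1). *)
Definition flag_mx (x : F) : 'M[F]_2 :=
  \matrix_(i, j) if i == 0 then (j == 1)%:R else if j == 0 then 1 else x.

Lemma flag_mx_unit x : flag_mx x \is a GRing.unit.
Proof.
rewrite -[_ \is a _]/(flag_mx x \in unitmx) unitmxE.
rewrite (expand_det_row _ 0) big_ord_recl big_ord1 /cofactor !det_mx11 !mxE /=.
by rewrite mul0r add0r mul1r mulr1 unitrX // unitrN1.
Qed.

Definition flag_rep (t : option F) : {'GL_2[F]} :=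
  if t is Some x then FinRing.Unit (flag_mx_unit x) else 1%g.

Lemma flag_repE x (i j : 'I_2) :
  gl2_mx (flag_rep (Some x)) i j =
  if i == 0 then (j == 1)%:R else if j == 0 then 1 else x.
Proof. by rewrite /gl2_mx /= mxE. Qed.

Lemma flag_repP g : exists t, gl2_mx (g * (flag_rep t)^-1)%g 1 0 = 0.
Proof.
have [g0|g10] := eqVneq (gl2_mx g 1 0) 0; first by exists None; rewrite invg1 mulg1.
exists (Some (gl2_mx g 1 1 / gl2_mx g 1 0)).
set h := flag_rep _; set k := (g * h^-1)%g.
have g1 (j : 'I_2) :
    gl2_mx g 1 j = gl2_mx k 1 0 * gl2_mx h 0 j + gl2_mx k 1 1 * gl2_mx h 1 j.
  by rewrite -gl2_mxM mulgKV.
have := g1 0; rewrite !flag_repE /= mulr0 add0r mulr1 => k11.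
have := g1 1; rewrite !flag_repE /= mulr1 -k11 [_ * (_ / _)]mulrC divfK //.
by move=> E; apply: (addIr (gl2_mx g 1 1)); rewrite add0r; apply: esym.
Qed.

Lemma flag_rep_inj t u : gl2_mx (flag_rep t * (flag_rep u)^-1)%g 1 0 = 0 -> t = u.
Proof.
set k := (_ * _)%g => k0; have E : flag_rep t = (k * flag_rep u)%g by rewrite mulgKV.
have E0 : gl2_mx (flag_rep t) 1 0 = gl2_mx k 1 1 * gl2_mx (flag_rep u) 1 0.
  by rewrite E gl2_mxM k0 mul0r add0r.
have E1 : gl2_mx (flag_rep t) 1 1 = gl2_mx k 1 1 * gl2_mx (flag_rep u) 1 1.
  by rewrite E gl2_mxM k0 mul0r add0r.
move: E0 E1; case: (t) (u) => [x|] [y|]; rewrite ?flag_repE ?gl2_mx1 ?mxE //=.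
- by rewrite mulr1 => <-; rewrite mul1r => ->.
- by rewrite mulr0 => /eqP; rewrite oner_eq0.
- by rewrite mulr1 => <-; rewrite mul0r => /eqP; rewrite oner_eq0.
Qed.

(** The jets of P at all rational points. The two index sets,
smallexp * option F here and smallexp * normal_index for [span_comb], have the
same cardinality because there are p^f = #|F| functions from 'I_f to 'I_p. *)
Definition coords P : {ffun smallexp * option F -> F^o} :=
  [ffun y => (hasse (poly_act p (flag_rep y.2) P))@_(mon m (expo y.1))].

Lemma coordsE P y :
  coords P y = (hasse (poly_act p (flag_rep y.2) P))@_(mon m (expo y.1)).
Proof. by rewrite ffunE. Qed.

Lemma coords_linear : linear coords.
Proof.
move=> c P Q; apply/ffunP=> y.
transitivity (c * coords P y + coords Q y); last by rewrite [RHS]ffunE [in RHS]ffunE.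
apply: (etrans (coordsE _ _)).
rewrite (linearP (poly_act p (flag_rep y.2))) (linearP hasse) mcoeffD mcoeffZ.
by apply/esym; congr (_ * _ + _); apply: coordsE.
Qed.

HB.instance Definition _ :=
  GRing.isLinear.Build F {mpoly F[f + f]} {ffun smallexp * option F -> F^o} *:%R
    coords coords_linear.

Lemma coords_in_ideal P : in_ideal theta_gen P -> coords P = 0.
Proof.
by move=> hP; apply/ffunP=> y; rewrite !ffunE hasse_act_in_ideal // mcoeff0.
Qed.

Lemma poly_act_homog g P : P \in multihomog r -> poly_act p g P \in multihomog r.
Proof. exact: (@multihomog_stable p f F p_pr cardF). Qed.

Lemma hasse_flag_local_poly (i0 : 'I_f) (x y : smallexp * option F) :
  (hasse (poly_act p (flag_rep y.2 * (flag_rep x.2)^-1)%g (local_poly i0 x.1)))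
    @_(mon m (expo y.1)) = (hbin (expo x.1))%:R * (y == x)%:R.
Proof.
case: x y => [x1 x2] [y1 y2] /=; rewrite xpair_eqE.
have [->|ne] := eqVneq y2 x2; last first.
  rewrite andbF mulr0 hasse_act_local_poly ?mcoeff0 //.
  by apply: contra_neq ne; apply: flag_rep_inj.
rewrite (mulgV (flag_rep x2)) (poly_act1 p_pr) hasse_local_poly mcoeffZ mcoeffX.
rewrite andbT mon_eqX; congr (_ * _%:R); congr nat_of_bool.
apply/forallP/eqP => [E|->] //.
by apply: expo_inj => i; apply/esym/eqP/E.
Qed.

Lemma coords_surj (i0 : 'I_f) w : exists2 P, P \in multihomog r & coords P = w.
Proof.
exists (\sum_x (w x / (hbin (expo x.1))%:R)
          *: poly_act p (flag_rep x.2)^-1%g (local_poly i0 x.1)).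
  by apply: multihomog_sum => x; apply/multihomogZ/poly_act_homog/local_poly_homog.
have coordsZ c g P y : coords (c *: poly_act p g P) y
    = c * (hasse (poly_act p (flag_rep y.2 * g)%g P))@_(mon m (expo y.1)).
  by rewrite (linearZ_LR coords) ffunE coordsE -(poly_actM p_pr cardF).
rewrite (linear_sum coords); apply/ffunP=> y; rewrite sum_ffunE.
transitivity (\sum_x w x * (y == x)%:R).
  apply: eq_bigr => x _; rewrite coordsZ hasse_flag_local_poly mulrA.
  by rewrite divfK ?hbin_neq0.
rewrite (bigD1 y) // eqxx big1 => [|x /negPf yx]; last first.
  by rewrite eq_sym yx mulr0.
by rewrite mulr1 /= addr0.
Qed.

(** A surjection between finite sets of the same cardinality is injective. *)
Lemma coords_span_inj (i0 : 'I_f) c : coords (span_comb c) = 0 -> c = 0.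
Proof.
pose T c := coords (span_comb c).
have surjT w : w \in codom T.
  have [P hP <-] := coords_surj i0 w; have [u hu] := homog_spanned hP.
  have := coords_in_ideal hu; rewrite (raddfB coords) => /eqP; rewrite subr_eq0 => /eqP ->.
  exact: codom_f.
have injT : injective T.
  apply/injectiveP/card_uniqP; rewrite size_map -cardE.
  have -> : #|codom T| = #|{: {ffun smallexp * option F -> F^o}}|.
    by apply: eq_card => w; rewrite surjT.
  by rewrite !card_ffun !card_prod !card_option card_ffun !card_ord cardF.
by move=> c0; apply: injT; rewrite /T c0 !raddf0.
Qed.

Lemma coords_eq0 (i0 : 'I_f) P :
  P \in multihomog r -> coords P = 0 -> in_ideal theta_gen P.
Proof.
move=> hP P0; have [c hc] := homog_spanned hP.
have := coords_in_ideal hc; rewrite (raddfB coords) /= P0 sub0r => /eqP; rewrite oppr_eq0.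
move=> /eqP /(coords_span_inj i0) c0.
by move: hc; rewrite c0 raddf0 subr0.
Qed.

(** * The isomorphism *)

Local Notation Vr := (Vrep p_pr cardF r).
Local Notation Vm := (Vrep p_pr cardF m).
Local Notation sigma := (twist_rep (res_rep (borel F) Vm) (dchar F p r m)).

Definition hasse_rep (v : Vr) : Vm :=
  @Subspace F _ (@poly_rep p f F p_pr cardF) (@multihomog F f m) _
    (hasse_homog (subspace_val v)).

(** The morphism attached by Frobenius reciprocity to the Borel morphism
[hasse_rep]. *)
Definition jet_fun (v : Vr) : {ffun {'GL_2[F]} -> sigma} :=
  [ffun g => hasse_rep (rep_act Vr g v)].

Lemma jet_fun_equivariant v : jet_fun v \in equivariant (V := sigma).
Proof.
apply/equivariantP=> b g; rewrite !ffunE; apply: val_inj => /=.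
have := subgP b; rewrite inE => /eqP b10.
rewrite -[RHS](hasse_upper_act b10 (poly_act_homog g (valP v))).
by congr (hasse _); apply: poly_actM.
Qed.

Definition jet (v : Vr) : ind_rep sigma := Subspace (jet_fun_equivariant v).

Lemma jet_linear : linear jet.
Proof.
move=> c u v; apply: val_inj; apply/ffunP=> g; rewrite !ffunE; apply: val_inj => /=.
by rewrite (linearP (poly_act p g)) (linearP hasse).
Qed.

HB.instance Definition _ :=
  GRing.isLinear.Build F Vr (ind_rep sigma) *:%R jet jet_linear.

Lemma jet_act g v : jet (rep_act Vr g v) = rep_act (ind_rep sigma) g (jet v).
Proof.
apply: val_inj; apply/ffunP=> x; rewrite !ffunE; apply: val_inj => /=.
by congr (hasse _); apply: esym; apply: poly_actM.
Qed.

Definition ind_coord (u : ind_rep sigma) (y : smallexp * option F) : F :=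
  (subspace_val (subspace_val u (flag_rep y.2) : Vm))@_(mon m (expo y.1)).

Lemma ind_coord_jet (v : Vr) y : ind_coord (jet v) y = coords (subspace_val v) y.
Proof. by rewrite coordsE /ind_coord ffunE. Qed.

(** An equivariant function is determined by its values at coset
representatives. *)
Lemma ind_coord_inj u u' : ind_coord u =1 ind_coord u' -> u = u'.
Proof.
move=> E; apply: val_inj; apply/ffunP=> g; have [t gt0] := flag_repP g.
have bB : (g * (flag_rep t)^-1)%g \in borel F by rewrite inE gt0.
have -> : g = (sgval (Subg bB) * flag_rep t)%g by rewrite /= mulgKV.
move/equivariantP: (valP u) => ->; move/equivariantP: (valP u') => ->.
congr (rep_act _ _ _); apply: val_inj.
apply: (multihomog_ext (valP (_ : Vm)) (valP (_ : Vm))) => k km.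
have [a ak] := expoP km; rewrite -(eq_mon (fun=> erefl) ak).
exact: (E (a, t)).
Qed.

Lemma jet_surj (i0 : 'I_f) u : exists v, jet v = u.
Proof.
have [P hP E] := coords_surj i0 [ffun y => ind_coord u y].
exists (@Subspace F _ (@poly_rep p f F p_pr cardF) (@multihomog F f r) P hP).
by apply: ind_coord_inj => y; rewrite ind_coord_jet E ffunE.
Qed.

Lemma jet_ker (i0 : 'I_f) (v : Vr) :
  jet v = 0 <-> v \in theta_span m.
Proof.
split=> [v0|/asboolP hv].
  apply/asboolP; apply: (coords_eq0 i0); first exact: (valP v).
  apply/ffunP=> y; rewrite -ind_coord_jet v0 /ind_coord !ffunE; exact: mcoeff0.
apply: ind_coord_inj => y; rewrite ind_coord_jet coords_in_ideal // /ind_coord !ffunE.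
by apply/esym; exact: mcoeff0.
Qed.

Lemma jet_rep_iso (i0 : 'I_f) : rep_iso (Vquot p_pr cardF r m) (ind_rep sigma).
Proof.
pose Q := Vquot p_pr cardF r m.
pose phi (x : Q) : ind_rep sigma := jet (generic_quotient.repr x).
pose proj (v : Vr) : Q := (\pi_(quot_space (@theta_span p f F p_pr cardF r m)) v)%qT.
have projP u v : proj u = proj v <-> u - v \in theta_span m by apply: quot_piP.
have projW (A : Q -> Prop) : (forall v, A (proj v)) -> forall x, A x.
  exact: quot_spaceW.
have projK x : proj (generic_quotient.repr x) = x by apply: reprK.
have phiE v : phi (proj v) = jet v.
  apply/eqP; rewrite -subr_eq0 -(raddfB jet); apply/eqP/(jet_ker i0)/projP.
  exact: projK.
have phi_linear : linear phi.
  move=> c; elim/projW=> u; elim/projW=> v.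
  have -> : c *: proj u + proj v = proj (c *: u + v).
    apply: esym; apply: (etrans (quot_piD _ _ _)); congr (_ + _).
    by apply: esym; apply: quot_scaleE.
  by rewrite !phiE; apply: jet_linear.
pose phiL := GRing.isLinear.Build F Q (ind_rep sigma) *:%R phi phi_linear.
pose Phi : {linear Q -> ind_rep sigma} := HB.pack phi phiL.
exists Phi; split=> [|g]; last first.
  elim/projW=> v.
  change (phi (rep_act Q g (proj v)) = rep_act (ind_rep sigma) g (phi (proj v))).
  have -> : rep_act Q g (proj v) = proj (rep_act Vr g v).
    exact: (quot_actE (@theta_span_stable p f F p_pr cardF r m)).
  by rewrite !phiE; apply: jet_act.
have [psi psiK] := choice (jet_surj i0).
exists (fun u => proj (psi u)) => [|u]; last by rewrite /= phiE psiK.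
elim/projW=> v /=; rewrite phiE; apply/projP/(jet_ker i0).
by apply/eqP; rewrite (raddfB jet) subr_eq0; apply/eqP; apply: psiK.
Qed.

End BorelMap.

Theorem theorem1p3 (p f : nat) (F : finFieldType) (p_pr : prime p)
    (f_gt0 : (0 < f)%N) (cardF : #|F| = (p ^ f)%N) (m r : 'I_f -> nat)
    (m_le : forall i, (m i <= p - 1)%N)
    (r_ge : forall i, ((m i + 1) * (p ^ f + 1) - 1 <= r i)%N)
    (binom_ndvd : ~~ (p %| \prod_(i < f) 'C(r i, m i))%N) :
  rep_iso (Vquot p_pr cardF r m)
          (ind_rep (twist_rep (res_rep (borel F) (Vrep p_pr cardF m))
                              (dchar F p r m))).
Proof.
have p_gt0 := prime_gt0 p_pr.
have m_lt i : (m i < p)%N by move: (m_le i); lia.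
have r_ge' i : ((m i).+1 * (p ^ f).+1 <= (r i).+1)%N by move: (r_ge i); lia.
have m_le_r i : (m i <= r i)%N by move: (r_ge' i); nia.
have ndvd i : ~~ (p %| 'C(r i, m i))%N.
  apply: contra binom_ndvd => dvd.
  by apply: dvdn_trans dvd _; rewrite (bigD1 i) //= dvdn_mulr.
exact: (jet_rep_iso p_pr cardF m_lt m_le_r r_ge' ndvd (Ordinal f_gt0)).
Qed.
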